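(* Let $s\ge 1$ be an integer. The Lah numbers with higher level (level $s$) satisfy the following identities. (1) Recurrence relation: for all integers $n\ge k\ge 1$, $$\left\lfloor\!\!\left\lfloor\begin{matrix} n\\ k\end{matrix}\right\rfloor\!\!\right\rfloor_{s}=\left\lfloor\!\!\left\lfloor\begin{matrix} n-1\\ k-1\end{matrix}\right\rfloor\!\!\right\rfloor_{s}+(n+k-1)^s\left\lfloor\!\!\left\lfloor\begin{matrix} n-1\\ k\end{matrix}\right\rfloor\!\!\right\rfloor_{s}.$$ (2) Explicit formula: for all integers $n\ge k\ge 0$, $$\left\lfloor\!\!\left\lfloor\begin{matrix} n\\ k\end{matrix}\right\rfloor\!\!\right\rfloor_{s}=\sum_{1\le j_1<j_2<\dots<j_{n-k}\le n}(2j_1-2)^s(2j_2-3)^s\cdots(2j_{n-k}-(n-k+1))^s,$$ where the $i$-th factor of each summand is $(2j_i-(i+1))^s$, and for $k=n$ the right-hand side is $1$ (a single empty product). (3) For all integers $n\ge 1$, $$\left\lfloor\!\!\left\lfloor\begin{matrix} n\\ n-1\end{matrix}\right\rfloor\!\!\right\rfloor_{s}=2^s\sum_{j=1}^{n-1}j^s.$$ (4) For all integers $n\ge 1$, $$\left\lfloor\!\!\left\lfloor\begin{matrix} n\\ 1\end{matrix}\right\rfloor\!\!\right\rfloor_{s}=\left(\left\lfloor\begin{matrix} n\\ 1\end{matrix}\right\rfloor\right)^s=(n!)^s.$$ (5) For all integers $n\ge 1$, the polynomials $L_n^s(x)=\sum_{k=0}^n\left\lfloor\!\!\left\lfloor\begin{matrix}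 n\\ k\end{matrix}\right\rfloor\!\!\right\rfloor_{s}x^k$ satisfy $$L_{n+1}^{s}(x)=x\,L_n^s(x)+\sum_{j=0}^s\binom{s}{j}n^{s-j}\sum_{i=0}^j\left\{\begin{matrix} j\\ i\end{matrix}\right\}x^i\frac{d^i}{dx^i}L_n^s(x).$$
   Context: $[n]=\{1,2,\dots,n\}$ (with $[0]=\emptyset$). A partition of $[n]$ into $k$ lists is a set partition of $[n]$ into $k$ non-empty blocks, each block equipped with a linear order. For a partition $\pi=\{b_1,\dots,b_k\}$ the set of block leaders is $\operatorname{bl}\pi=\{\min b_1,\dots,\min b_k\}$ (minima with respect to the usual order of integers). The Lah number with higher level (level $s$), $\left\lfloor\!\!\left\lfloor\begin{matrix} n\\ k\end{matrix}\right\rfloor\!\!\right\rfloor_{s}$, is the number of ordered $s$-tuples $(\pi_1,\dots,\pi_s)$ of partitions of $[n]$ into $k$ lists such that $\operatorname{bl}\pi_1=\dots=\operatorname{bl}\pi_s$. It equals $1$ for $n=k=0$ and $0$ for $n<k$. $\left\lfloor\begin{matrix} n\\ k\end{matrix}\right\rfloor$ is the ordinary Lah number: the number of partitions of $[n]$ into $k$ lists. $\left\{\begin{matrix} j\\ i\end{matrix}\right\}$ is the ordinary Stirling number of the second kind. *)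

(* Defs.v *)
From mathcomp Require Import all_boot all_order all_algebra.

Set Implicit Arguments.
Unset Strict Implicit.
Unset Printing Implicit Defensive.

(* The ground set [n] = {1, ..., n} is represented by 'I_n, with i : 'I_n
   standing for i + 1; only the order of its elements is ever used. *)

Section ListPartitions.

Variable n : nat.

(* A linearly ordered block is a duplicate-free sequence of its elements.
   Such a sequence has at most n entries, hence the finite type of bounded
   sequences. *)
Definition block_list := {bseq n of 'I_n}.

Definition block (l : block_list) : {set 'I_n} := [set i in l].

(* The underlying sets are the blocks of a set partition of [n] into k blocks (in
   [partition], blocks are non-empty), and each block carries exactly one list:
   this is the injectivity clause. *)
Definition list_partition (k : nat) (P : {set block_list}) : bool :=
  [&& [forall l in P, uniq l], dinjectiveb block P,
      partition (block @: P) [set: 'I_n] & #|block @: P| == k].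

Definition is_min (l : block_list) (i : 'I_n) : bool :=
  (i \in l) && [forall j in l, i <= j].

Definition bl (P : {set block_list}) : {set 'I_n} :=
  [set i | [exists l in P, is_min l i]].

End ListPartitions.

Definition lah (n k : nat) : nat :=
  #|[set P : {set block_list n} | list_partition k P]|.

Definition lah_level (s n k : nat) : nat :=
  #|[set p : s.-tuple {set block_list n} |
      [forall a, list_partition k (tnth p a)]
      && [forall a, forall b, bl (tnth p a) == bl (tnth p b)]]|.

Definition stirling2 (n k : nat) : nat :=
  #|[set P : {set {set 'I_n}} | partition P [set: 'I_n] && (#|P| == k)]|.

Local Open Scope ring_scope.

Definition lah_poly (s n : nat) : {poly int} :=
  \sum_(k < n.+1) (lah_level s n k)%:R *: 'X^k.

(* Index sequences 1 <= j_1 < ... < j_m <= n; the index is 0-based, that is,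
   j_(i+1) is [j i], whereas the values are the actual integers. *)
Definition increasing_seq (m n : nat) (j : {ffun 'I_m -> 'I_n.+1}) : bool :=
  [forall i, (1 <= j i)%N]
  && [forall i : 'I_m, forall i' : 'I_m, (i < i')%N ==> (j i < j i')%N].

(* Main.v *)
Require Import Defs.
From mathcomp Require Import all_boot all_order all_algebra.
From mathcomp Require Import zify.

(** Everything follows from one recurrence in [n], which comes from deleting the
    largest element.  Fix the set [B] of leaders.  If the largest element of
    {1, ..., n+1} is a leader, its list is a singleton, since any other entry
    would be smaller; removing it is a bijection.  If it is not a leader, its
    removal leaves a list partition of {1, ..., n} with the same leaders, and it
    can be put back before any of the [n] elements or at the end of any of the
    [#|B|] lists, that is, in [n + #|B|] ways ([card_assignmentsS]).  This number
    depends on [B] through its cardinal only.  The Lah number of level [s] is the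
    sum over [B] with [#|B| = k] of the [s]-th power of the number of list
    partitions with leaders [B] ([lah_level_sum]); hence [lah_levelS]:
      L(n+1, k) = L(n, k-1) + (n+k)^s L(n, k).

    The explicit formula holds because its right-hand side satisfies the same
    recurrence, the last index of an increasing sequence being the largest
    element or not ([inc_sumSS], [lah_level_inc_sum]).  The values for
    [k = n - 1] and [k = 1] are telescoped recurrences.  For the polynomials,
    the factor (n+k)^s is expanded by the binomial theorem and each power k^j is
    written in falling factorials with Stirling numbers as coefficients
    ([expn_stirling2]); the falling factorial of order [i] is the eigenvalue of
    x^i d^i/dx^i on x^k. *)

Set Implicit Arguments.
Unset Strict Implicit.
Unset Printing Implicit Defensive.

(** * List partitions as assignments *)

(** The assignment sends each element to the list that contains it.  Unlike a
    set of lists, it can be built and compared element by element, and being a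
    list partition becomes a condition with three elementwise clauses. *)
Definition list_assignment n (F : {ffun 'I_n -> block_list n}) : bool :=
  [forall x, [&& x \in F x, uniq (F x) & [forall y in F x, F y == F x]]].

Lemma list_assignmentP n (F : {ffun 'I_n -> block_list n}) :
  reflect [/\ forall x, x \in F x, forall x, uniq (F x)
            & forall x y, y \in F x -> F y = F x]
          (list_assignment F).
Proof.
apply: (iffP forallP) => [H | [H1 H2 H3] x].
  split=> [x | x | x y yx]; have /and3P[// _ _ /forallP Hy] := H x.
  by apply/eqP; move: (Hy y); rewrite yx.
by rewrite H1 H2 /=; apply/forallP=> y; apply/implyP=> /H3 ->.
Qed.

Definition leaders n (F : {ffun 'I_n -> block_list n}) : {set 'I_n} :=
  [set x | is_min (F x) x].

(** Every list has exactly one minimum, so that lists and leaders are in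
    bijection. *)
Lemma card_leaders n (F : {ffun 'I_n -> block_list n}) :
  list_assignment F -> #|F @: [set: 'I_n]| = #|leaders F|.
Proof.
case/list_assignmentP=> F1 F2 F3.
have <-: F @: leaders F = F @: [set: 'I_n].
  apply/eqP; rewrite eqEsubset imsetS ?subsetT //=.
  apply/subsetP=> _ /imsetP[x _ ->].
  case: (arg_minnP (fun y : 'I_n => y : nat) (F1 x)) => y /F3 yx ymin.
  apply/imsetP; exists y => //; rewrite inE /is_min F1 yx /=.
  by apply/forallP=> z; apply/implyP=> /ymin.
apply: card_in_imset => x y; rewrite !inE => /andP[xx /forallP xmin].
move=> /andP[yy /forallP ymin] exy; apply/val_inj/eqP; rewrite eqn_leq /=.
by rewrite (implyP (xmin y)) ?(implyP (ymin x)) // ?exy // -exy.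
Qed.

Lemma list_partition_imset n (F : {ffun 'I_n -> block_list n}) :
  list_assignment F -> list_partition #|leaders F| (F @: [set: 'I_n]).
Proof.
move=> FA; have /list_assignmentP[F1 F2 F3] := FA.
have binj : {in F @: [set: 'I_n] &, injective (@block n)}.
  move=> _ _ /imsetP[x _ ->] /imsetP[y _ ->] /setP/(_ x).
  by rewrite !inE F1 => /esym/F3.
apply/and4P; split; last by rewrite card_in_imset // card_leaders.
- by apply/forallP=> l; apply/implyP=> /imsetP[x _ ->].
- exact/dinjectiveP.
- apply/and3P; split.
  + rewrite eqEsubset subsetT /=; apply/subsetP=> x _.
    apply/bigcupP; exists (block (F x)); first by rewrite !imset_f.
    by rewrite inE.
  + apply/trivIsetP=> b c /imsetP[l /imsetP[x _ ->] ->{b l}].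
    move=> /imsetP[l /imsetP[y _ ->] ->{c l}]; apply: contraNT.
    case/pred0Pn=> z /=; rewrite !inE => /andP[/F3 zx /F3 zy].
    by rewrite -zx -zy.
  + apply/imsetP=> -[_ /imsetP[x _ ->]] /setP/(_ x).
    by rewrite !inE F1.
Qed.

Lemma bl_imset n (F : {ffun 'I_n -> block_list n}) :
  list_assignment F -> bl (F @: [set: 'I_n]) = leaders F.
Proof.
case/list_assignmentP=> F1 F2 F3; apply/setP=> x; rewrite !inE.
apply/existsP/idP => [[_ /andP[/imsetP[y _ ->] mx]] | mx].
  by rewrite (F3 y x) //; case/andP: mx.
by exists (F x); rewrite imset_f.
Qed.

Lemma imset_assignment_inj n (F G : {ffun 'I_n -> block_list n}) :
    list_assignment F -> list_assignment G ->
  F @: [set: 'I_n] = G @: [set: 'I_n] -> F = G.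
Proof.
case/list_assignmentP=> F1 _ _ /list_assignmentP[_ _ G3] eFG.
apply/ffunP=> x; have: F x \in G @: setT by rewrite -eFG imset_f.
by case/imsetP=> y _ e; rewrite e (G3 y) // -e.
Qed.

(** The assignment of [P] picks a list of [P] through each element; disjointness
    of the blocks makes this choice unique. *)
Lemma list_partition_assignment n k (P : {set block_list n}) :
    list_partition k P ->
  exists2 F : {ffun 'I_n -> block_list n},
    list_assignment F & F @: [set: 'I_n] = P.
Proof.
case/and4P=> /forallP Pu /dinjectiveP Pinj /and3P[/eqP Pc /trivIsetP Pt P0] _.
(* The default [bseq] is never reached, since the blocks cover. *)
pose F := [ffun x : 'I_n =>
             odflt [bseq] [pick l : block_list n | (l \in P) && (x \in l)]].
have FP x : (F x \in P) /\ x \in F x.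
  rewrite ffunE; case: pickP => [l /andP[] // | no].
  have: x \in cover (block (n:=n) @: P) by rewrite Pc inE.
  case/bigcupP=> _ /imsetP[l lP ->]; rewrite inE => xl.
  by have:= no l; rewrite lP xl.
have Puniq x l : l \in P -> x \in l -> F x = l.
  move=> lP xl; have [FxP xFx] := FP x.
  apply: Pinj => //; apply/eqP; apply: contraTT isT => ne.
  have /pred0P/(_ x) := Pt _ _ (imset_f _ FxP) (imset_f _ lP) ne.
  by rewrite /= !inE xFx xl.
exists F.
  apply/list_assignmentP; split=> [x | x | x y]; have [FxP xFx] // := FP x.
    exact: (implyP (Pu _)).
  exact: Puniq.
apply/setP=> l; apply/imsetP/idP => [[x _ ->] | lP]; first by have [] := FP x.
case: (set_0Vmem (block l)) => [l0 | [x]].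
  by case/imsetP: P0; exists l.
by rewrite inE => xl; exists x; rewrite // (Puniq x l).
Qed.

Definition assignments n (B : {set 'I_n}) : {set {ffun 'I_n -> block_list n}} :=
  [set F | list_assignment F & leaders F == B].

Lemma card_list_partitions_bl n k (B : {set 'I_n}) :
  #|[set P : {set block_list n} | list_partition k P & bl P == B]|
  = if #|B| == k then #|assignments B| else 0.
Proof.
case: ifPn => [/eqP <- | Bk].
  have <-: (fun F : {ffun 'I_n -> block_list n} => F @: [set: 'I_n])
     @: assignments B
    = [set P : {set block_list n} | list_partition #|B| P & bl P == B].
    apply/setP=> P; rewrite inE; apply/imsetP/idP => [[F] | ].
      rewrite inE => /andP[FA /eqP <-] ->.
      by rewrite list_partition_imset // bl_imset /=.
    case/andP=> /list_partition_assignment[F FA <-].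
    by rewrite bl_imset // => FB; exists F; rewrite // inE FA FB.
  apply: card_in_imset => F G; rewrite !inE => /andP[FA _] /andP[GA _].
  exact: imset_assignment_inj.
apply/eqP; rewrite cards_eq0; apply/eqP/setP=> P; rewrite !inE.
apply: contraNF Bk => /andP[PL].
have [F FA eP] := list_partition_assignment PL.
rewrite -eP bl_imset // => /eqP <-; rewrite -card_leaders // eP.
have /and4P[_ /dinjectiveP Pinj _] := PL.
by rewrite card_in_imset.
Qed.

(** * Deleting and inserting the maximum in a list *)

Definition del n (l : block_list n.+1) : block_list n :=
  insub_bseq n (pmap (unlift ord_max) l).

(** [del] and [lift_list] identify 'I_n with the elements of 'I_n.+1 other than
    [ord_max].  The truncation in [insub_bseq] is harmless for [lift_list] always, and
    for [del] on duplicate-free lists. *)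
Definition lift_list n (l : block_list n) : block_list n.+1 :=
  insub_bseq n.+1 [seq lift ord_max x | x <- l].

Lemma size_uniq_ord n (s : seq 'I_n) : uniq s -> size s <= n.
Proof. by move=> /card_uniqP <-; rewrite -[X in _ <= X]card_ord max_card. Qed.

Lemma val_insub_bseq n T (s : seq T) : size s <= n -> insub_bseq n s = s :> seq T.
Proof. by move=> ns; rewrite /insub_bseq insubdK. Qed.

Lemma unliftK n (h : 'I_n.+1) : ocancel (unlift h) (lift h).
Proof. by move=> x; case: unliftP. Qed.

Lemma val_del n (l : block_list n.+1) :
  uniq l -> del l = pmap (unlift ord_max) l :> seq _.
Proof.
by move=> ul; rewrite val_insub_bseq ?size_uniq_ord ?(pmap_uniq (@unliftK _ _)).
Qed.

Lemma mem_del n (l : block_list n.+1) x :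
  uniq l -> (x \in del l) = (lift ord_max x \in l).
Proof.
move=> ul; rewrite -[LHS]/(x \in (del l : seq _)) val_del //.
exact: (can2_mem_pmap (@unliftK _ _) (@liftK _ _)).
Qed.

Lemma del_uniq n (l : block_list n.+1) : uniq l -> uniq (del l).
Proof. by move=> ul; rewrite val_del // (pmap_uniq (@unliftK _ _)). Qed.

Lemma val_lift_list n (l : block_list n) :
  lift_list l = [seq lift ord_max x | x <- l] :> seq _.
Proof. by rewrite val_insub_bseq // size_map (leq_trans (size_bseq l)). Qed.

Lemma lift_list_uniq n (l : block_list n) : uniq (lift_list l) = uniq l.
Proof. by rewrite val_lift_list map_inj_uniq //; apply: lift_inj. Qed.

Lemma mem_lift_list n (l : block_list n) x : (lift ord_max x \in lift_list l) = (x \in l).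
Proof.
rewrite -[LHS]/(_ \in (lift_list l : seq _)) val_lift_list mem_map //; exact: lift_inj.
Qed.

Lemma max_lift_list n (l : block_list n) : ord_max \notin lift_list l.
Proof.
rewrite -[X in ~~ X]/(_ \in (lift_list l : seq _)) val_lift_list.
by apply/mapP=> -[x _ e]; have := neq_lift ord_max x; rewrite -e eqxx.
Qed.

Lemma lift_listK n : cancel (@lift_list n) (@del n).
Proof.
move=> l; apply/val_inj; have e : pmap (unlift ord_max) (lift_list l) = l.
  by rewrite val_lift_list (map_pK (@liftK _ _)).
by rewrite /= val_insub_bseq e // size_bseq.
Qed.

Lemma map_lift_pmap_unlift n (h : 'I_n.+1) (s : seq 'I_n.+1) :
  h \notin s -> [seq lift h x | x <- pmap (unlift h) s] = s.
Proof.
elim: s => //= x s IH; rewrite inE negb_or => /andP[xh /IH e].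
by case: unliftP xh => [y -> _ | -> /eqP//]; rewrite /= e.
Qed.

Lemma delK n (l : block_list n.+1) : uniq l -> ord_max \notin l -> lift_list (del l) = l.
Proof.
move=> ul ml; apply/val_inj; rewrite /= val_lift_list val_del //.
rewrite -[X in _ = X]/(l : seq _); move: ml; rewrite -[X in ~~ X]/(_ \in (l : seq _)).
exact: map_lift_pmap_unlift.
Qed.

Definition insert_max n (l : block_list n) (p : nat) : block_list n.+1 :=
  insub_bseq n.+1 (take p (lift_list l) ++ ord_max :: drop p (lift_list l)).

Lemma val_insert_max n (l : block_list n) p :
  insert_max l p = take p (lift_list l) ++ ord_max :: drop p (lift_list l) :> seq _.
Proof.
rewrite val_insub_bseq // size_cat /= addnS -size_cat cat_take_drop.
by rewrite val_lift_list size_map ltnS size_bseq.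
Qed.

Lemma index_insert_max n (l : block_list n) p :
  p <= size l -> index ord_max (insert_max l p) = p.
Proof.
move=> pl; rewrite val_insert_max index_cat.
have -> : (ord_max \in take p (lift_list l)) = false.
  by apply: contraNF (max_lift_list l) => /mem_take.
by rewrite /= eqxx addn0 size_take_min val_lift_list size_map; apply/minn_idPl.
Qed.

Lemma insert_max_uniq n (l : block_list n) p : uniq l -> uniq (insert_max l p).
Proof.
move=> ul; rewrite val_insert_max uniq_catC /= mem_cat orbC.
by rewrite -mem_cat uniq_catC cat_take_drop lift_list_uniq ul andbT max_lift_list.
Qed.

Lemma max_insert_max n (l : block_list n) p : ord_max \in insert_max l p.
Proof.
rewrite -[X in is_true X]/(_ \in (insert_max l p : seq _)) val_insert_max.
by rewrite mem_cat mem_head orbT.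
Qed.

Lemma del_insert_max n (l : block_list n) p : uniq l -> del (insert_max l p) = l.
Proof.
move=> ul; apply/val_inj; rewrite /= val_del ?insert_max_uniq // val_insert_max.
rewrite pmap_cat /= unlift_none /= -pmap_cat cat_take_drop val_lift_list.
by rewrite (map_pK (@liftK _ _)).
Qed.

Lemma insert_max_del n (m : block_list n.+1) :
  uniq m -> ord_max \in m -> insert_max (del m) (index ord_max m) = m.
Proof.
move=> um mm; apply/val_inj; rewrite /= val_insert_max val_lift_list val_del //.
have {mm}: ord_max \in (m : seq _) by [].
move: (m : seq _) um => s us sm; case/splitPr: sm us => a b.
rewrite uniq_catC /= mem_cat negb_or => /andP[/andP[bm am] _].
rewrite index_cat (negPf am) /= eqxx addn0 pmap_cat /= unlift_none /=.
by rewrite map_cat !map_lift_pmap_unlift // take_size_cat // drop_size_cat.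
Qed.

(** The maximum can be inserted before each entry of [l] or at its end; the
    position is recovered as the index of the maximum. *)
Lemma card_insertions n (l : block_list n) : uniq l ->
  #|[set m : block_list n.+1 | [&& uniq m, ord_max \in m & del m == l]]|
  = (size l).+1.
Proof.
move=> ul; rewrite -[RHS]card_ord.
have <-: [set insert_max l (nat_of_ord p) | p : 'I_(size l).+1]
   = [set m : block_list n.+1 | [&& uniq m, ord_max \in m & del m == l]].
  apply/setP=> m; rewrite inE; apply/imsetP/and3P => [[p _ ->] | [um mm /eqP e]].
    by rewrite insert_max_uniq // max_insert_max del_insert_max.
  have lm : index ord_max m < (size l).+1.
    rewrite -{1}(insert_max_del um mm) e ltnS.
    rewrite -[X in is_true X]/(index _ (insert_max l _ : seq _) <= _).
    have: index ord_max m <= size (lift_list l).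
      have: index ord_max m < size m by rewrite index_mem.
      rewrite -{2}(insert_max_del um mm) e.
      rewrite val_insert_max size_cat /= addnS -size_cat cat_take_drop.
      by rewrite ltnS.
    by rewrite val_lift_list size_map => pl; rewrite index_insert_max.
  by exists (Ordinal lm); rewrite //= -e insert_max_del.
rewrite card_imset // => p q /(congr1 (fun m : block_list n.+1 => index ord_max m)).
have pl (r : 'I_(size l).+1) : r <= size l by rewrite -ltnS.
by rewrite !index_insert_max // => /val_inj.
Qed.

(** * Deleting the maximum in an assignment *)

Definition restrict n (F : {ffun 'I_n.+1 -> block_list n.+1}) :
    {ffun 'I_n -> block_list n} :=
  [ffun x => del (F (lift ord_max x))].

(** Inverse of [restrict], given the list [m] that is to contain the maximum.  The
    last [m] is a dummy value: it is reached for [ord_max] only, which lies in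
    [m] whenever [m] fits. *)
Definition extend n (F : {ffun 'I_n -> block_list n}) (m : block_list n.+1) :
    {ffun 'I_n.+1 -> block_list n.+1} :=
  [ffun z => if z \in m then m
             else if unlift ord_max z is Some x then lift_list (F x) else m].

(** The lists that can contain the maximum in an extension of [F]: without the
    maximum, they are empty or one of the lists of [F]. *)
Definition fits n (F : {ffun 'I_n -> block_list n}) : {set block_list n.+1} :=
  [set m : block_list n.+1 | [&& uniq m, ord_max \in m
                              & [forall x in del m, F x == del m]]].

Definition below n (B : {set 'I_n.+1}) : {set 'I_n} :=
  [set x | lift ord_max x \in B].

Lemma restrict_assignment n (F : {ffun 'I_n.+1 -> block_list n.+1}) :
  list_assignment F -> list_assignment (restrict F).
Proof.
case/list_assignmentP=> F1 F2 F3; apply/list_assignmentP.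
split=> [x | x | x y]; rewrite !ffunE ?mem_del ?del_uniq //.
by move=> /F3 ->.
Qed.

Lemma fits_max n (F : {ffun 'I_n.+1 -> block_list n.+1}) :
  list_assignment F -> F ord_max \in fits (restrict F).
Proof.
case/list_assignmentP=> F1 F2 F3; rewrite inE F1 F2 /=.
by apply/forallP=> x; apply/implyP; rewrite mem_del // ffunE => /F3 ->.
Qed.

Lemma extendK n (F : {ffun 'I_n.+1 -> block_list n.+1}) :
  list_assignment F -> extend (restrict F) (F ord_max) = F.
Proof.
case/list_assignmentP=> F1 F2 F3; apply/ffunP=> z; rewrite ffunE.
case: ifPn => [/F3 // | zm]; case: unliftP zm => [x -> zm | ->]; last by rewrite F1.
rewrite ffunE delK //; apply: contra zm => /F3 ->; exact: F1.
Qed.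

Lemma extend_max n (F : {ffun 'I_n -> block_list n}) m :
  m \in fits F -> extend F m ord_max = m.
Proof. by rewrite inE => /and3P[_ mm _]; rewrite ffunE mm. Qed.

Lemma restrictK n (F : {ffun 'I_n -> block_list n}) m :
  m \in fits F -> restrict (extend F m) = F.
Proof.
rewrite inE => /and3P[um mm /forallP Fm]; apply/ffunP=> x; rewrite !ffunE.
case: ifPn => [xm | _]; last by rewrite liftK lift_listK.
by apply/esym/eqP; apply: (implyP (Fm x)); rewrite mem_del.
Qed.

Lemma extend_assignment n (F : {ffun 'I_n -> block_list n}) m :
  list_assignment F -> m \in fits F -> list_assignment (extend F m).
Proof.
case/list_assignmentP=> F1 F2 F3; rewrite inE => /and3P[um mm /forallP Fm].
have insm z : z \in m -> extend F m z = m by rewrite ffunE => ->.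
have insx x : lift ord_max x \notin m -> extend F m (lift ord_max x) = lift_list (F x).
  by rewrite ffunE liftK => /negPf ->.
apply/list_assignmentP; split=> [z | z | z y].
- case: (boolP (z \in m)) => [zm | ]; first by rewrite insm.
  case: (unliftP ord_max z) => [x -> zm | -> /negP //].
  by rewrite insx // mem_lift_list.
- case: (boolP (z \in m)) => [zm | ]; first by rewrite insm.
  case: (unliftP ord_max z) => [x -> zm | -> /negP //].
  by rewrite insx // lift_list_uniq.
- case: (boolP (z \in m)) => [zm | ]; first by rewrite (insm z zm) => /insm.
  case: (unliftP ord_max z) => [x -> {z} xm | -> /negP //].
  rewrite (insx x) //; case: (unliftP ord_max y) => [w -> {y} | ->].
    rewrite mem_lift_list => wx; rewrite insx ?(F3 x w) //.
    apply: contra xm; rewrite -!mem_del // => wm.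
    by rewrite -(eqP (implyP (Fm w) wm)) (F3 x w).
  by move=> h; have := max_lift_list (F x); rewrite h.
Qed.

(** A new largest element never affects a minimum among the older ones. *)
Lemma leaders_restrict n (F : {ffun 'I_n.+1 -> block_list n.+1}) :
  list_assignment F -> below (leaders F) = leaders (restrict F).
Proof.
case/list_assignmentP=> F1 F2 F3; apply/setP=> x; rewrite !inE /is_min ffunE.
rewrite mem_del // F1 !andTb; apply/forallP/forallP => min_x y; apply/implyP.
  rewrite mem_del // => /(implyP (min_x _)).
  by rewrite !lift_max.
case: (unliftP ord_max y) => [z -> | -> _]; last by rewrite leq_ord.
by rewrite -mem_del // => /(implyP (min_x _)); rewrite !lift_max.
Qed.

(** The maximum is the minimum of its list only when it is alone there. *)
Lemma max_leaders n (F : {ffun 'I_n.+1 -> block_list n.+1}) :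
  list_assignment F ->
  (ord_max \in leaders F) = (del (F ord_max) == [bseq]).
Proof.
case/list_assignmentP=> F1 F2 F3; rewrite !inE /is_min F1 /=.
apply/forallP/eqP => [max_x | e y]; last first.
  apply/implyP; case: (unliftP ord_max y) => [z -> | -> //].
  by rewrite -mem_del // e.
apply/val_inj=> /=; case e: (del (F ord_max) : seq _) => [//|x s].
have : x \in del (F ord_max).
  by rewrite -[X in is_true X]/(x \in (del (F ord_max) : seq _)) e mem_head.
rewrite mem_del // => /(implyP (max_x _)); rewrite lift_max /=.
by rewrite leqNgt ltn_ord.
Qed.

Lemma sum_size_lists n (F : {ffun 'I_n -> block_list n}) :
  list_assignment F -> \sum_(l in F @: [set: 'I_n]) size l = n.
Proof.
case/list_assignmentP=> F1 F2 F3; rewrite -[RHS]card_ord -cardsT -sum1_card.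
rewrite (partition_big_imset F) /=; apply: eq_bigr => _ /imsetP[x _ ->].
rewrite sum1dep_card; have /card_uniqP <- := F2 x; apply: eq_card => y.
rewrite !inE; apply/idP/eqP => [/F3 // | <-]; exact: F1.
Qed.

(** If the maximum opens a list of its own, there is one choice.  Otherwise it
    is inserted into a list [l] of [F], in [size l + 1] ways; summing over the
    lists gives [n] plus the number of lists. *)
Lemma card_fits n (F : {ffun 'I_n -> block_list n}) b :
  list_assignment F ->
  #|[set m in fits F | (del m == [bseq]) == b]|
  = if b then 1 else n + #|leaders F|.
Proof.
move=> FA; have /list_assignmentP[F1 F2 F3] := FA; case: b.
  transitivity (size ([bseq] : block_list n)).+1 => //.
  rewrite -card_insertions //; apply: eq_card => m.
  rewrite !inE; case: (uniq m); case: (ord_max \in m) => //=; rewrite ?andbF //.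
  by rewrite eqb_id; case: eqP => [-> | _]; rewrite ?andbF // andbT; apply/forallP.
rewrite -sum1_card (partition_big (@del n) (mem (F @: [set: 'I_n]))) /=; last first.
  move=> m; rewrite !inE => /andP[/and3P[um mm /forallP Fm]].
  rewrite eqbF_neg => m0.
  case e: (del m : seq _) => [|x s].
    by case/negP: m0; apply/eqP/val_inj.
  have xm : x \in del m.
    by rewrite -[X in is_true X]/(x \in (del m : seq _)) e mem_head.
  by rewrite -(eqP (implyP (Fm x) xm)) imset_f.
rewrite -card_leaders // -[n in n + _](sum_size_lists FA) -sum1_card -big_split /=.
apply: eq_bigr => _ /imsetP[x _ ->]; rewrite addn1 -card_insertions //.
rewrite sum1dep_card; apply: eq_card => m; rewrite !inE.
case: (uniq m); case: (ord_max \in m) => //=; rewrite ?andbF //.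
case: (del m =P F x) => [-> | _]; rewrite ?andbF // andbT eqbF_neg.
apply/andP; split.
  by apply/forallP=> y; apply/implyP=> /F3 ->.
by apply: contraL (F1 x) => /eqP ->.
Qed.

(** The key count.  The number of extensions by a non-leader depends on the
    leaders through their number only; this is why it can be raised to the power
    [s] for [s]-tuples with common leaders. *)
Lemma card_assignmentsS n (B : {set 'I_n.+1}) :
  #|assignments B| = #|assignments (below B)|
                     * (if ord_max \in B then 1 else n + #|below B|).
Proof.
rewrite -sum1_card (partition_big (@restrict n) (mem (assignments (below B)))) /=.
  rewrite -sum_nat_const; apply: eq_bigr => F; rewrite inE => /andP[FA /eqP FB].
  rewrite sum1dep_card -FB -card_fits //.
  have <-: (fun G : {ffun 'I_n.+1 -> block_list n.+1} => G ord_max)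
      @: [set G | (G \in assignments B) && (restrict G == F)]
    = [set m in fits F | (del m == [bseq]) == (ord_max \in B)].
    apply/setP=> m; rewrite inE; apply/imsetP/andP => [[G] | [mF /eqP mB]].
      rewrite inE => /andP[+ /eqP eF] ->; rewrite inE => /andP[GA /eqP GB].
      by rewrite -eF fits_max // -max_leaders // GB.
    have IA := extend_assignment FA mF.
    exists (extend F m); last by rewrite extend_max.
    rewrite !inE IA restrictK // eqxx andbT /=; apply/eqP/setP=> z.
    case: (unliftP ord_max z) => [x -> | ->]; last by rewrite max_leaders // extend_max.
    have /setP/(_ x) := leaders_restrict IA; rewrite restrictK // inE => ->.
    by rewrite FB inE.
  apply/esym/card_in_imset => G H; rewrite !inE => /andP[/andP[GA _] /eqP eG].
  by move=> /andP[/andP[HA _] /eqP eH] e; rewrite -(extendK GA) -(extendK HA) e eG eH.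
move=> F; rewrite !inE => /andP[FA /eqP <-].
by rewrite restrict_assignment //= leaders_restrict.
Qed.

(** * The recurrence of the Lah numbers of level s *)

Lemma card_tuples_in (T : finType) s (A : {set T}) :
  #|[set p : s.-tuple T | [forall a, tnth p a \in A]]| = #|A| ^ s.
Proof.
rewrite -[s in RHS]card_ord -card_ffun_on.
rewrite -(card_imset (f := fun p : s.-tuple T => [ffun a => tnth p a])).
  apply: eq_card => f; apply/imsetP/ffun_onP => [[p] | fA].
    by rewrite inE => /forallP pA -> a; rewrite ffunE.
  exists [tuple f a | a < s].
    by rewrite inE; apply/forallP=> a; rewrite tnth_mktuple.
  by apply/ffunP=> a; rewrite ffunE tnth_mktuple.
by move=> p q /ffunP e; apply: eq_from_tnth => a; have := e a; rewrite !ffunE.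
Qed.

(** A tuple with common leaders [B] is an arbitrary [s]-tuple of list partitions
    with leaders [B].  For [s = 0] the empty tuple has no leaders to sort by. *)
Lemma lah_level_sum s n k : 0 < s ->
  lah_level s n k = \sum_(B : {set 'I_n} | #|B| == k) #|assignments B| ^ s.
Proof.
case: s => // s _; rewrite /lah_level -sum1_card.
rewrite (partition_big (fun p => bl (tnth p ord0)) predT) //=.
rewrite [RHS]big_mkcond /=; apply: eq_bigr => B _; rewrite sum1dep_card.
have -> : (if #|B| == k then #|assignments B| ^ s.+1 else 0)
    = #|[set P : {set block_list n} | list_partition k P & bl P == B]| ^ s.+1.
  by rewrite card_list_partitions_bl; case: ifP; rewrite ?exp0n.
rewrite -card_tuples_in; apply: eq_card => p; rewrite !inE.
apply/andP/forallP => [[/andP[/forallP pL /forallP pB] /eqP <-] a | pB].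
  by rewrite inE pL /=; exact: (forallP (pB a)).
have pLB a : list_partition k (tnth p a) /\ bl (tnth p a) = B.
  by have := pB a; rewrite inE => /andP[-> /eqP ->].
split; last by rewrite (pLB ord0).2.
apply/andP; split; first by apply/forallP=> a; have [] := pLB a.
by apply/forallP=> a; apply/forallP=> b; rewrite (pLB a).2 (pLB b).2.
Qed.

Lemma below_lift n (B : {set 'I_n}) : below (lift ord_max @: B) = B.
Proof. by apply/setP=> x; rewrite inE mem_imset //; apply: lift_inj. Qed.

Lemma max_lift n (B : {set 'I_n}) : ord_max \notin lift ord_max @: B.
Proof. by apply/imsetP=> -[x _ e]; have := neq_lift ord_max x; rewrite -e eqxx. Qed.

Lemma below_setU1 n (B : {set 'I_n.+1}) : below (ord_max |: B) = below B.
Proof.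
by apply/setP=> x; rewrite !inE eq_sym (negPf (neq_lift _ _)).
Qed.

Lemma belowK n (B : {set 'I_n.+1}) : lift ord_max @: below B = B :\ ord_max.
Proof.
apply/setP=> z; rewrite !inE; case: (unliftP ord_max z) => [x -> | ->].
  by rewrite mem_imset ?inE; [rewrite eq_sym neq_lift | apply: lift_inj].
by rewrite eqxx (negPf (max_lift _)).
Qed.

(** A subset of 'I_n.+1 is a subset of 'I_n together with the choice whether to
    add the maximum. *)
Lemma sum_setsS n (f : {set 'I_n.+1} -> nat) :
  \sum_B f B = \sum_(B : {set 'I_n})
                 (f (ord_max |: lift ord_max @: B) + f (lift ord_max @: B)).
Proof.
rewrite (bigID (fun B : {set _} => ord_max \in B)) /= big_split /=; congr (_ + _).
  rewrite (reindex_onto (fun B : {set 'I_n} => ord_max |: lift ord_max @: B) (@below n)) /=.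
    by apply: eq_bigl => B; rewrite setU11 below_setU1 below_lift eqxx.
  by move=> B mB; rewrite belowK setD1K.
rewrite (reindex_onto (fun B : {set 'I_n} => lift ord_max @: B) (@below n)) /=.
  by apply: eq_bigl => B; rewrite max_lift below_lift eqxx.
move=> B mB; rewrite belowK; apply/setP=> z; rewrite !inE.
by case: eqP mB => // -> /negPf ->.
Qed.

(** The two terms come from the leader sets that contain the maximum and from
    those that do not. *)
Lemma lah_levelS s n k : 0 < s ->
  lah_level s n.+1 k = (if k is k'.+1 then lah_level s n k' else 0)
                       + (n + k) ^ s * lah_level s n k.
Proof.
move=> s0; rewrite lah_level_sum // big_mkcond sum_setsS big_split /=.
have cardB (B : {set 'I_n}) : #|lift ord_max @: B| = #|B|.
  by rewrite card_imset //; apply: lift_inj.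
congr (_ + _).
  transitivity (\sum_(B : {set 'I_n} | #|B|.+1 == k) #|assignments B| ^ s).
    rewrite [RHS]big_mkcond /=; apply: eq_bigr => B _.
    rewrite cardsU1 max_lift cardB card_assignmentsS below_setU1 below_lift.
    by rewrite setU11 muln1.
  by case: k => [|k]; rewrite ?lah_level_sum // big_pred0.
rewrite lah_level_sum // big_distrr [RHS]big_mkcond /=; apply: eq_bigr => B _.
rewrite cardB; case: eqP => // <-.
by rewrite card_assignmentsS below_lift (negPf (max_lift _)) expnMn mulnC.
Qed.

Lemma lah_level00 s : 0 < s -> lah_level s 0 0 = 1.
Proof.
move=> s0; rewrite lah_level_sum // (big_pred1 set0); last first.
  move=> B /=; rewrite -leqn0 -[X in _ <= X](card_ord 0) max_card.
  by apply/esym/eqP/setP=> -[].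
rewrite (_ : #|_| = 1) ?exp1n //; apply/eqP/cards1P; exists [ffun => [bseq]].
apply/setP=> F; rewrite !inE.
have -> : F = [ffun => [bseq]] by apply/ffunP=> -[].
rewrite eqxx; apply/andP; split; first by apply/forallP=> -[].
by apply/eqP/setP=> -[].
Qed.

Lemma lah_level_small s n k : 0 < s -> n < k -> lah_level s n k = 0.
Proof.
move=> s0 nk; rewrite lah_level_sum // big_pred0 // => B; apply/negbTE.
by rewrite neq_ltn (leq_ltn_trans _ nk) // -[X in _ <= X]card_ord max_card.
Qed.

Local Open Scope ring_scope.
Import GRing.Theory.

(** * Sums over increasing sequences *)

Section IncreasingSums.
Variables (R : comNzRingType) (g : nat -> nat -> R).

Definition inc_sum (m n : nat) : R :=
  \sum_(j : {ffun 'I_m -> 'I_n.+1} | increasing_seq j) \prod_(i < m) g i (j i).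

Lemma increasing_seqP m n (j : {ffun 'I_m -> 'I_n.+1}) :
  reflect ((forall i, (0 < j i)%N) /\ {homo j : i i' / (i < i')%N})
          (increasing_seq j).
Proof.
apply: (iffP andP) => -[/forallP-j0 jlt]; split=> //.
  by move=> i i'; apply/implyP; move/forallP/(_ i)/forallP/(_ i'): jlt.
by apply/forallP=> i; apply/forallP=> i'; apply/implyP/jlt.
Qed.

Lemma inc_sum0 n : inc_sum 0 n = 1.
Proof.
rewrite /inc_sum (big_pred1 [ffun => ord0]) ?big_ord0 // => j.
have -> : j = [ffun => ord0] by apply/ffunP=> -[].
by rewrite /= eqxx; apply/increasing_seqP; split=> -[].
Qed.

Lemma inc_sumS0 m : inc_sum m.+1 0 = 0.
Proof.
apply: big_pred0 => j; apply: contraTF isT => /increasing_seqP[/(_ ord0)].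
by rewrite ord1.
Qed.

(** Either the last index is [n.+1], and contributes the factor [g m n.+1], or
    all indices are at most [n]. *)
Lemma inc_sumSS m n :
  inc_sum m.+1 n.+1 = inc_sum m.+1 n + inc_sum m n * g m n.+1.
Proof.
rewrite [LHS](bigID (fun j : {ffun 'I_m.+1 -> 'I_n.+2} => j ord_max == ord_max)).
rewrite /= [LHS]addrC; congr (_ + _).
  pose h (j : {ffun 'I_m.+1 -> 'I_n.+1}) : {ffun 'I_m.+1 -> 'I_n.+2} :=
    [ffun i => lift ord_max (j i)].
  rewrite (reindex_onto h (fun j => [ffun i => inord (j i)])) /=; last first.
    move=> j /andP[/increasing_seqP[_ jlt] jm]; apply/ffunP=> i; rewrite !ffunE.
    apply: ord_inj; rewrite lift_max inordK //.
    have jmn : (j ord_max < n.+1)%N by rewrite ltn_neqAle jm -ltnS ltn_ord.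
    have [->//|im] := eqVneq i ord_max.
    by apply: ltn_trans jmn; apply: jlt; rewrite ltn_neqAle im -ltnS ltn_ord.
  apply: eq_big => [j | j _]; last by apply: eq_bigr => i _; rewrite ffunE lift_max.
  have -> : [ffun i => inord (h j i)] = j.
    by apply/ffunP=> i; rewrite !ffunE lift_max inord_val.
  rewrite eqxx andbT ffunE eq_sym neq_lift andbT.
  by apply/increasing_seqP/increasing_seqP => -[j0 jlt]; split=> [i|i i' /jlt];
    move: (j0 i); rewrite ?ffunE ?lift_max.
pose h (j : {ffun 'I_m -> 'I_n.+1}) : {ffun 'I_m.+1 -> 'I_n.+2} :=
  [ffun i => if unlift ord_max i is Some x then lift ord_max (j x) else ord_max].
have hl j x : h j (lift ord_max x) = lift ord_max (j x) by rewrite ffunE liftK.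
have hm j : h j ord_max = ord_max by rewrite ffunE unlift_none.
rewrite (reindex_onto h (fun j => [ffun i => inord (j (lift ord_max i))])) /=; last first.
  move=> j /andP[/increasing_seqP[_ jlt] /eqP jm]; apply/ffunP=> i.
  case: (unliftP ord_max i) => [x -> | ->]; last by rewrite hm jm.
  rewrite hl ffunE; apply: ord_inj; rewrite lift_max inordK //.
  have : (j (lift ord_max x) < j ord_max)%N by apply: jlt; rewrite lift_max /=.
  by rewrite jm.
rewrite /inc_sum big_distrl /=; apply: eq_big => [j | j _]; last first.
  rewrite big_ord_recr /= hm; congr (_ * _); apply: eq_bigr => i _.
  have -> : widen_ord (leqnSn m) i = lift ord_max i by apply: ord_inj; rewrite lift_max.
  by rewrite hl lift_max.
have -> : [ffun i => inord (h j (lift ord_max i))] = j.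
  by apply/ffunP=> i; rewrite ffunE hl lift_max inord_val.
rewrite eqxx andbT hm eqxx andbT.
apply/increasing_seqP/increasing_seqP => -[j0 jlt]; split=> [i|i i'].
- by have := j0 (lift ord_max i); rewrite hl lift_max.
- by have := jlt (lift ord_max i) (lift ord_max i'); rewrite !hl !lift_max.
- by case: (unliftP ord_max i) => [x -> | ->]; rewrite ?hm // hl lift_max.
case: (unliftP ord_max i) => [x -> | ->]; last by rewrite ltnNge leq_ord.
case: (unliftP ord_max i') => [y -> | ->]; last by rewrite hl hm !lift_max => _; exact: ltn_ord.
by rewrite !hl !lift_max; apply: jlt.
Qed.

Lemma inc_sum_small m n : (n < m)%N -> inc_sum m n = 0.
Proof.
elim: n m => [|n IH] [|m] // nm; first exact: inc_sumS0.
by rewrite inc_sumSS IH ?(ltnW nm) // IH // mul0r addr0.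
Qed.

End IncreasingSums.

(** * The explicit formula *)

Definition lah_factor s (i j : nat) : int := (2 * j%:R - (i.+1 + 1)%:R) ^+ s.

(** If [n.+1] is the last of the [n.+1 - k] non-leaders, then [k] leaders and
    [n - k] non-leaders precede it, and the factor is the number [n + k] of its
    insertion positions, to the power [s]. *)
Lemma lah_factor_sub s n k : (k <= n)%N ->
  lah_factor s (n - k) n.+1 = ((n + k) ^ s)%N%:R.
Proof.
move=> kn; rewrite /lah_factor natrX; congr (_ ^+ s); apply/eqP.
rewrite subr_eq -!natrM -natrD; apply/eqP; congr (_%:R).
by lia.
Qed.

Lemma lah_level_inc_sum s n k : (0 < s)%N -> (k <= n)%N ->
  (lah_level s n k)%:R = inc_sum (lah_factor s) (n - k) n.
Proof.
move=> s0; elim: n k => [|n IH] k.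
  by rewrite leqn0 => /eqP ->; rewrite lah_level00 // inc_sum0.
case: k => [|k] kn.
  rewrite lah_levelS // add0n subn0 inc_sumSS inc_sum_small // add0r.
  have := lah_factor_sub s (leq0n n); rewrite subn0 => ->.
  by rewrite natrM IH // subn0 mulrC.
rewrite subSS lah_levelS // natrD natrM IH //.
move: kn; rewrite ltnS leq_eqVlt => /orP[/eqP-> | kn].
  by rewrite subnn !inc_sum0 lah_level_small // mulr0 addr0.
by rewrite -[(n - k)%N](subnSK kn) inc_sumSS IH // lah_factor_sub // mulrC.
Qed.

(** * Stirling numbers and the Lah polynomials *)

(** A function with kernel [P] is an injective function on the blocks of [P]. *)
Lemma card_preim_partition (T U : finType) (P : {set {set T}}) :
    partition P [set: T] ->
  #|[set f : {ffun T -> U} | preim_partition f [set: T] == P]| = (#|U| ^_ #|P|)%N.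
Proof.
move=> PT; have /and3P[/eqP Pc Pt P0] := PT.
have pbP x : pblock P x \in P by rewrite pblock_mem ?Pc.
pose cls x : {B | B \in P} := Sub (pblock P x) (pbP x).
have <-: #|{: {B | B \in P}}| = #|P|.
  by rewrite card_sig; apply: eq_card => B; rewrite inE.
rewrite -card_inj_ffuns.
have <-: (fun g : {ffun {B | B \in P} -> U} => [ffun x => g (cls x)])
    @: [set g : {ffun {B | B \in P} -> U} | injectiveb g]
  = [set f : {ffun T -> U} | preim_partition f [set: T] == P].
  apply/setP=> f; rewrite inE; apply/imsetP/eqP => [[g] | fP].
    rewrite inE => /injectiveP ginj ->.
    rewrite -[RHS](preim_partition_pblock PT); apply: eq_imset => x.
    apply/setP=> y; by rewrite !inE !ffunE (inj_eq ginj).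
  have fpb x y : (f x == f y) = (y \in pblock P x).
    rewrite -fP pblock_equivalence_partition ?inE //.
    by split=> // /eqP ->.
  have rep (B : {B | B \in P}) : {x | x \in val B}.
    case: (set_0Vmem (val B)) => [B0|//].
    by case/negP: P0; rewrite -B0 (valP B).
  have pbrep B : pblock P (sval (rep B)) = val B.
    exact: def_pblock Pt (valP B) (svalP (rep B)).
  exists [ffun B => f (sval (rep B))].
    rewrite inE; apply/injectiveP=> B C; rewrite !ffunE => /eqP.
    rewrite fpb pbrep => CB; apply/val_inj.
    by rewrite -[RHS]pbrep (def_pblock Pt (valP B) CB).
  by apply/ffunP=> x; rewrite !ffunE; apply/eqP; rewrite fpb -eq_pblock ?Pc ?inE // pbrep.
rewrite card_imset // => g h /ffunP e; apply/ffunP=> B.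
case: (set_0Vmem (val B)) => [B0|[x xB]].
  by case/negP: P0; rewrite -B0 (valP B).
have := e x; rewrite !ffunE (_ : cls x = B) //.
by apply/val_inj; rewrite SubK; apply: def_pblock Pt (valP B) xB.
Qed.

Lemma card_partition_le (T : finType) (P : {set {set T}}) :
  partition P [set: T] -> (#|P| <= #|T|)%N.
Proof.
move=> PT; have /and3P[_ _ P0] := PT.
rewrite -cardsT (card_partition PT) -sum1_card leq_sum // => B BP.
by rewrite card_gt0; apply: contraNneq P0 => <-.
Qed.

(** Both sides count the functions from 'I_j to 'I_k, on the right by the number
    [i] of blocks of their kernel. *)
Lemma expn_stirling2 k j :
  (k ^ j = \sum_(i < j.+1) stirling2 j i * k ^_ i)%N.
Proof.
rewrite -[X in (X ^ _)%N]card_ord -[X in (_ ^ X)%N]card_ord -card_ffun -sum1_card.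
rewrite (partition_big (fun f : {ffun 'I_j -> 'I_k} => preim_partition f [set: 'I_j])
  (fun P => partition P [set: 'I_j])) /=; last by move=> f _; apply: preim_partitionP.
rewrite (partition_big (fun P : {set {set 'I_j}} => inord #|P| : 'I_j.+1) predT) //=.
apply: eq_bigr => i _; rewrite /stirling2 -sum_nat_const; apply: eq_big => [P | P].
  rewrite inE; case PT: (partition P _) => //=.
  by rewrite -val_eqE /= inordK // ltnS -[X in (_ <= X)%N]card_ord card_partition_le.
case/andP=> PT /eqP <-; rewrite sum1dep_card card_preim_partition // card_ord inordK //.
by rewrite ltnS -[X in (_ <= X)%N]card_ord card_partition_le.
Qed.

Lemma coef_lah_poly s n k : (0 < s)%N -> (lah_poly s n)`_k = (lah_level s n k)%:R.
Proof.
move=> s0; rewrite coef_sumMXn; case: (ltnP k n.+1) => [kn | nk].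
  by rewrite (big_pred1 (Ordinal kn)).
rewrite lah_level_small // big_pred0 // => i.
by apply/negbTE; rewrite neq_ltn (leq_trans (ltn_ord i)).
Qed.

(** On 'X^k, the operator 'X^i * d^i acts as multiplication by [k ^_ i], so that
    by [expn_stirling2] the inner sum acts as multiplication by [k ^ j], and by
    the binomial theorem the whole sum acts as multiplication by [(n + k) ^ s]. *)
Lemma lah_polyS s n : (0 < s)%N ->
  lah_poly s n.+1
  = 'X * lah_poly s n
    + \sum_(j < s.+1) ('C(s, j) * n ^ (s - j))%:R *:
        \sum_(i < j.+1) (stirling2 j i)%:R *: ('X^i * (lah_poly s n)^`(i)).
Proof.
move=> s0; apply/polyP=> k; rewrite coefD coefXM !coef_lah_poly // lah_levelS //.
rewrite natrD; congr (_ + _); first by case: k.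
rewrite expnDn big_distrl natr_sum coef_sum; apply: eq_bigr => j _.
rewrite /= coefZ coef_sum mulnA -mulnA natrM; congr (_ * _).
rewrite expn_stirling2 big_distrl natr_sum /=; apply: eq_bigr => i _.
rewrite coefZ -mulnA natrM; congr (_ * _).
rewrite coefXnM coef_derivn coef_lah_poly //.
case: ltnP => [ki | ik]; first by rewrite ffact_small.
by rewrite subnKC // mulnC natrM mulr_natr.
Qed.

(** * Boundary values and the conclusion *)

Lemma lah_level_diag s n : (0 < s)%N -> lah_level s n n = 1%N.
Proof.
move=> s0; elim: n => [|n IH]; first exact: lah_level00.
by rewrite lah_levelS // IH lah_level_small // muln0.
Qed.

Lemma lah_level0 s n : (0 < s)%N -> (0 < n)%N -> lah_level s n 0 = 0%N.
Proof.
move=> s0; case: n => // n _; elim: n => [|n IH]; rewrite lah_levelS //.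
  by rewrite exp0n.
by rewrite IH muln0.
Qed.

Lemma lah_level_subdiag s n : (0 < s)%N ->
  lah_level s n.+1 n = (2 ^ s * \sum_(1 <= j < n.+1) j ^ s)%N.
Proof.
move=> s0; elim: n => [|n IH].
  by rewrite lah_level0 // big_geq // muln0.
rewrite lah_levelS // IH lah_level_diag // muln1 [in RHS]big_nat_recr //= mulnDr.
by rewrite -expnMn mul2n -addnn.
Qed.

Lemma lah_level1 s n : (0 < s)%N -> (0 < n)%N -> lah_level s n 1 = (n`! ^ s)%N.
Proof.
move=> s0; case: n => // n _; elim: n => [|n IH].
  by rewrite lah_level_diag // exp1n.
by rewrite lah_levelS // lah_level0 // IH add0n -expnMn addn1 -factS.
Qed.

Lemma lah_lah_level n k : lah n k = lah_level 1 n k.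
Proof.
rewrite lah_level_sum // /lah -sum1_card (partition_big (@bl n) predT) //=.
rewrite [RHS]big_mkcond /=; apply: eq_bigr => B _; rewrite sum1dep_card expn1.
by rewrite -card_list_partitions_bl; apply: eq_card => P; rewrite !inE.
Qed.

Theorem corollary2p4 (s : nat) (hs : (1 <= s)%N) :
  [/\ (forall n k : nat, (1 <= k)%N -> (k <= n)%N ->
         lah_level s n k
         = (lah_level s (n - 1) (k - 1)
            + (n + k - 1) ^ s * lah_level s (n - 1) k)%N),
      (forall n k : nat, (k <= n)%N ->
         (lah_level s n k)%:R
         = \sum_(j : {ffun 'I_(n - k) -> 'I_n.+1} | increasing_seq j)
             \prod_(i < n - k) (2 * (j i : nat)%:R - (i.+1 + 1)%:R) ^+ s
         :> int),
      (forall n : nat, (1 <= n)%N ->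
         lah_level s n (n - 1) = (2 ^ s * \sum_(1 <= j < n) j ^ s)%N),
      (forall n : nat, (1 <= n)%N ->
         lah_level s n 1 = (lah n 1 ^ s)%N /\ (lah n 1 ^ s)%N = (n`! ^ s)%N)
    & (forall n : nat, (1 <= n)%N ->
         lah_poly s n.+1
         = 'X * lah_poly s n
           + \sum_(j < s.+1) ('C(s, j) * n ^ (s - j))%:R *:
               \sum_(i < j.+1) (stirling2 j i)%:R *:
                 ('X^i * (lah_poly s n)^`(i)))].
Proof.
split=> [[|n] [|k] // _ kn | n k kn | [|n] // _ | n n0 | n _].
- by rewrite lah_levelS // !subn1 addSn.
- exact: lah_level_inc_sum.
- by rewrite subn1 lah_level_subdiag.
- by rewrite lah_lah_level !lah_level1 // expn1.
- exact: lah_polyS.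
Qed.
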